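(* Let $G=(A\cup B,E)$ be a bipartite graph in which every node has a strict ranking of its neighbors, and let $M$ be a maximum matching in $G$. Then $M$ is a popular max-matching if and only if (1) there is no $M$-alternating cycle $C$ with $\mathsf{wt}_M(C)>0$, and (2) there is no $M$-alternating path $p$ having a node unmatched in $M$ as an endpoint with $\mathsf{wt}_M(p)>0$.
   Context: Node $u$ prefers matching $M$ to matching $N$ if either $u$ is matched in $M$ and unmatched in $N$, or $u$ is matched in both and prefers its partner in $M$ to its partner in $N$. Let $\phi(M,N)$ be the number of nodes preferring $M$ to $N$ and $\Delta(M,N)=\phi(M,N)-\phi(N,M)$. A maximum matching $M$ is a popular max-matching if $\Delta(M,N)\ge0$ for all maximum matchings $N$ of $G$. For a matching $M$, an edge $(a,b)$ blocks $M$ if each of $a,b$ is either unmatched in $M$ or prefers the other to its partner in $M$. Define $\mathsf{wt}_M:E\to\{0,\pm2\}$ by $\mathsf{wt}_M(a,b)=2$ if $(a,b)$ blocks $M$; $\mathsf{wt}_M(a,b)=-2$ if $a$ and $b$ both prefer their assignments in $M$ to each other; and $\mathsf{wt}_M(a,b)=0$ otherwise (so $\mathsf{wt}_M(e)=0$ for $e\in M$). For a path or cycle $\rho$, $\mathsf{wt}_M(\rho)=\sum_{e\in\rho}\mathsf{wt}_M(e)$. *)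

(* Defs.v *)
From mathcomp Require Import all_boot all_order all_algebra.

Set Implicit Arguments.
Unset Strict Implicit.
Unset Printing Implicit Defensive.

Import GRing.Theory Num.Theory.

Local Open Scope ring_scope.

(* Edges and matchings are sets of vertex sets; the edge (u, v) is the
   two-element set [set u; v]. *)

Definition bipartite (V : finType) (A B : {set V}) (E : {set {set V}}) : Prop :=
  [/\ A :|: B = [set: V], [disjoint A & B] &
      forall e, e \in E ->
        exists a b, [/\ a \in A, b \in B & e = [set a; b]]].

Definition neighbors (V : finType) (E : {set {set V}}) (u : V) : {set V} :=
  [set v | [set u; v] \in E].

(* pref u v w means that u strictly prefers v to w; nothing is assumed about
   pref u outside the neighbors of u. *)
Definition strict_rankings (V : finType) (E : {set {set V}})
    (pref : V -> rel V) : Prop :=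
  forall u,
    [/\ {in neighbors E u, irreflexive (pref u)},
        {in neighbors E u & &, transitive (pref u)} &
        {in neighbors E u &, forall v w, v != w -> pref u v w || pref u w v}].

Definition matching (V : finType) (E M : {set {set V}}) : bool :=
  (M \subset E) && trivIset M.

Definition maximum_matching (V : finType) (E M : {set {set V}}) : Prop :=
  matching E M /\ forall N, matching E N -> (#|N| <= #|M|)%N.

Definition matched (V : finType) (M : {set {set V}}) (u : V) : bool :=
  u \in cover M.

Definition prefers_matching (V : finType) (pref : V -> rel V)
    (M N : {set {set V}}) (u : V) : bool :=
  (matched M u && ~~ matched N u) ||
  [exists v, exists w,
     [&& [set u; v] \in M, [set u; w] \in N & pref u v w]].

Definition phi (V : finType) (pref : V -> rel V) (M N : {set {set V}}) : nat :=
  #|[set u | prefers_matching pref M N u]|.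

Definition Delta (V : finType) (pref : V -> rel V) (M N : {set {set V}}) : int :=
  (phi pref M N)%:Z - (phi pref N M)%:Z.

Definition popular_max_matching (V : finType) (E : {set {set V}})
    (pref : V -> rel V) (M : {set {set V}}) : Prop :=
  maximum_matching E M /\
  forall N, maximum_matching E N -> 0 <= Delta pref M N.

Definition prefers_to_partner (V : finType) (pref : V -> rel V)
    (M : {set {set V}}) (u v : V) : bool :=
  [exists w, ([set u; w] \in M) && pref u v w].

Definition prefers_partner_to (V : finType) (pref : V -> rel V)
    (M : {set {set V}}) (u v : V) : bool :=
  [exists w, ([set u; w] \in M) && pref u w v].

Definition blocks (V : finType) (E : {set {set V}}) (pref : V -> rel V)
    (M : {set {set V}}) (a b : V) : bool :=
  [&& [set a; b] \in E,
      ~~ matched M a || prefers_to_partner pref M a b &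
      ~~ matched M b || prefers_to_partner pref M b a].

Definition wt (V : finType) (E : {set {set V}}) (pref : V -> rel V)
    (M : {set {set V}}) (a b : V) : int :=
  if blocks E pref M a b then 2
  else if prefers_partner_to pref M a b && prefers_partner_to pref M b a then -2
  else 0.

Definition adjacent (V : finType) (E : {set {set V}}) : rel V :=
  fun u v => [set u; v] \in E.

Definition path_edges (V : finType) (x : V) (p : seq V) : seq {set V} :=
  pairmap (fun u v => [set u; v]) x p.

Definition alternate (V : finType) (M : {set {set V}}) : rel {set V} :=
  fun e f => (e \in M) != (f \in M).

(* The path visits x, then the vertices of p in order. *)
Definition alternating_path (V : finType) (E M : {set {set V}})
    (x : V) (p : seq V) : bool :=
  [&& path (adjacent E) x p, uniq (x :: p) &
      sorted (alternate M) (path_edges x p)].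

(* The cycle visits x, then the vertices of p in order, then returns to x. *)
Definition alternating_cycle (V : finType) (E M : {set {set V}})
    (x : V) (p : seq V) : bool :=
  [&& cycle (adjacent E) (x :: p), uniq (x :: p), (2 < size (x :: p))%N &
      cycle (alternate M) (path_edges x (rcons p x))].

Definition wt_path (V : finType) (E : {set {set V}}) (pref : V -> rel V)
    (M : {set {set V}}) (x : V) (p : seq V) : int :=
  \sum_(z <- pairmap (wt E pref M) x p) z.

Definition wt_cycle (V : finType) (E : {set {set V}}) (pref : V -> rel V)
    (M : {set {set V}}) (x : V) (p : seq V) : int :=
  wt_path E pref M x (rcons p x).

(* Main.v *)
Require Import Defs.
From mathcomp Require Import all_boot all_order all_algebra zify.

Set Implicit Arguments.
Unset Strict Implicit.
Unset Printing Implicit Defensive.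

Import Order.TTheory GRing.Theory Num.Theory.

Local Open Scope ring_scope.

(** For maximum matchings M and N, an edge of N contributes to the election of N
    against M exactly its weight wt_M, edges of M have weight 0, and each node left
    unmatched by N alone costs N one vote.  Hence N beats M if and only if it does so
    on some component of the symmetric difference.  On an alternating cycle the margin
    is the weight of the cycle.  As neither matching can be augmented, every path
    component has even length, and the margin there is its weight minus one, which is
    positive exactly when the weight is, since weights are even.  Conversely, a positive
    alternating path starting at an unmatched node can be closed off by one more edge
    of M, of weight 0, and swapping along it, or along a positive alternating cycle,
    yields a maximum matching that beats M. *)

(** * Matchings in a loopless graph as involutions on the nodes *)

(** Excludes loops, which would be singletons [[set u; u]]; a fixed point of [partner] can then only
    mean an unmatched node. *)
Definition simple_edges (V : finType) (E : {set {set V}}) : Prop :=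
  forall e, e \in E -> exists a b, a != b /\ e = [set a; b].

Lemma bipartite_simple (V : finType) (A B : {set V}) (E : {set {set V}}) :
  bipartite A B E -> simple_edges E.
Proof.
case=> _ dAB abE e /abE [a [b [aA bB ->]]]; exists a, b; split=> //.
by apply: contraTneq bB => <-; rewrite (disjointFr dAB aA).
Qed.

Lemma simple_edge_neq (V : finType) (E : {set {set V}}) (u v : V) :
  simple_edges E -> [set u; v] \in E -> u != v.
Proof.
move=> sE /sE [a [b [ab /(congr1 (fun e : {set V} => #|e|))]]].
by rewrite !cards2 ab; case: eqVneq.
Qed.

Lemma set2_inj (V : finType) (u v w : V) : [set u; v] = [set u; w] -> v = w.
Proof.
move=> e; have := set22 u v; rewrite e !inE => /orP [/eqP vu|/eqP //].
by have := set22 u w; rewrite -e vu !inE orbb => /eqP.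
Qed.

(** The default [u] makes unmatched nodes fixed points, so that a matching becomes a total
    involution. *)
Definition partner (V : finType) (M : {set {set V}}) (u : V) : V :=
  odflt u [pick v | [set u; v] \in M].

Lemma mem_matching (V : finType) (E M : {set {set V}}) (u v : V) :
  simple_edges E -> matching E M ->
  ([set u; v] \in M) = (partner M u == v) && (u != v).
Proof.
move=> sE /andP [/subsetP sME /trivIsetP tM].
apply/idP/idP => [uvM|].
  rewrite (simple_edge_neq sE (sME _ uvM)) andbT /partner.
  case: pickP => [w uwM /=|/(_ v)]; last by rewrite uvM.
  case: (eqVneq [set u; v] [set u; w]) => [/set2_inj -> //|ne].
  by have /disjointFr/(_ (set21 u v)) := tM _ _ uvM uwM ne; rewrite set21.
case/andP => /eqP <-; rewrite /partner; case: pickP => //= _.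
by rewrite eqxx.
Qed.

Lemma partner_edge (V : finType) (E M : {set {set V}}) (u : V) :
  simple_edges E -> matching E M -> partner M u != u ->
  [set u; partner M u] \in M.
Proof. by move=> sE mM nu; rewrite (mem_matching _ _ sE mM) eqxx eq_sym. Qed.

Lemma partnerK (V : finType) (E M : {set {set V}}) :
  simple_edges E -> matching E M -> involutive (partner M).
Proof.
move=> sE mM u; case: (eqVneq (partner M u) u) => [e|nu]; first by rewrite !e.
have := partner_edge sE mM nu; rewrite setUC (mem_matching _ _ sE mM).
by case/andP => /eqP.
Qed.

Lemma matched_partner (V : finType) (E M : {set {set V}}) (u : V) :
  simple_edges E -> matching E M -> matched M u = (partner M u != u).
Proof.
move=> sE mM; apply/idP/idP => [/bigcupP [e eM]|nu].
  case/andP: (mM) => /subsetP sME _; case: (sE _ (sME _ eM)) => a [b [ab ee]].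
  rewrite ee in eM *; rewrite !inE => /orP [] /eqP ->; last rewrite setUC in eM.
    by move: eM; rewrite (mem_matching _ _ sE mM) => /andP [/eqP ->]; rewrite eq_sym.
  by move: eM; rewrite (mem_matching _ _ sE mM) => /andP [/eqP ->]; rewrite eq_sym.
by apply/bigcupP; exists [set u; partner M u]; rewrite ?set21 ?(partner_edge sE mM).
Qed.

(** The edges of [M] are disjoint pairs covering exactly the non-fixed points. Maximality can thus
    be tested by counting unmatched nodes. *)
Lemma card_matching (V : finType) (E M : {set {set V}}) :
  simple_edges E -> matching E M ->
  (#|[set u | partner M u == u]| + 2 * #|M| = #|V|)%N.
Proof.
move=> sE mM; case/andP: (mM) => /subsetP sME /eqP tM.
have <- : #|cover M| = (2 * #|M|)%N.
  rewrite -tM mulnC -sum_nat_const; apply: eq_bigr => e /sME /sE [a [b [ab ->]]].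
  by rewrite cards2 ab.
rewrite -(cardsC [set u | partner M u == u]); congr addn; apply: eq_card => u.
by rewrite !inE -(matched_partner _ sE mM).
Qed.

Definition matching_of (V : finType) (f : V -> V) : {set {set V}} :=
  [set [set u; f u] | u in [set u | f u != u]].

(** [matching_of] inverts [partner]: two edges [[set u; f u]] and [[set v; f v]] that share a node
    coincide, as [f] is an involution. *)
Lemma matching_ofP (V : finType) (E : {set {set V}}) (f : V -> V) :
  simple_edges E -> involutive f -> (forall u, f u != u -> [set u; f u] \in E) ->
  matching E (matching_of f) /\ partner (matching_of f) =1 f.
Proof.
move=> sE fK fE.
have mM : matching E (matching_of f).
  apply/andP; split.
    by apply/subsetP => e /imsetP [u]; rewrite inE => /fE ? ->.
  apply/trivIsetP => e1 e2 /imsetP [u _ ->] /imsetP [v _ ->].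
  rewrite -setI_eq0; apply: contraR => /set0Pn [w]; rewrite !inE.
  case/andP => /orP [] /eqP -> /orP [] /eqP E2.
  - by rewrite E2.
  - by rewrite E2 fK setUC.
  - by rewrite -E2 fK setUC.
  - by rewrite (inv_inj fK E2).
split=> // u; case: (eqVneq (f u) u) => fu.
  rewrite fu; apply/eqP; apply: contraTT isT => /(partner_edge sE mM).
  case/imsetP => v; rewrite inE => fv e.
  have : u \in [set v; f v] by rewrite -e set21.
  rewrite !inE => /orP [] /eqP uv; first by rewrite -uv fu eqxx in fv.
  by rewrite -{1}uv -fu uv fK eqxx in fv.
have : [set u; f u] \in matching_of f by apply: imset_f; rewrite inE.
by rewrite (mem_matching _ _ sE mM) => /andP [/eqP].
Qed.

Lemma maximum_of_card_fixed (V : finType) (E M N : {set {set V}}) :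
  simple_edges E -> maximum_matching E M -> matching E N ->
  (#|[set u | partner N u == u]| <= #|[set u | partner M u == u]|)%N ->
  maximum_matching E N.
Proof.
move=> sE [mM maxM] mN le; split=> // K mK.
have := card_matching sE mM; have := card_matching sE mN; have := maxM _ mK; lia.
Qed.

Lemma maximum_card_fixed (V : finType) (E M N : {set {set V}}) :
  simple_edges E -> maximum_matching E M -> matching E N ->
  (#|[set u | partner M u == u]| <= #|[set u | partner N u == u]|)%N.
Proof.
move=> sE [mM maxM] mN.
have := card_matching sE mM; have := card_matching sE mN; have := maxM _ mN; lia.
Qed.

(** * Votes of single nodes and their relation to edge weights *)

(** The sign favours [N], to agree with [wt], which is positive on blocking edges. *)
Definition vote (V : finType) (pref : V -> rel V) (M N : {set {set V}}) (u : V) : int :=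
  (prefers_matching pref N M u)%:Z - (prefers_matching pref M N u)%:Z.

Lemma sum_vote (V : finType) (pref : V -> rel V) (M N : {set {set V}}) :
  \sum_u vote pref M N u = - Delta pref M N.
Proof.
have phiE K L : (phi pref K L)%:Z = \sum_u (prefers_matching pref K L u)%:Z.
  rewrite /phi -sum1_card big_mkcond /= -[LHS]/(Posz _) raddf_sum /=.
  by apply: eq_bigr => u _; rewrite inE; case: prefers_matching.
by rewrite /Delta !phiE opprB -sumrB.
Qed.

Lemma prefers_matchingE (V : finType) (E M N : {set {set V}}) (pref : V -> rel V) (u : V) :
  simple_edges E -> matching E M -> matching E N ->
  prefers_matching pref M N u =
    (partner M u != u) && ((partner N u == u) || pref u (partner M u) (partner N u)).
Proof.
move=> sE mM mN; rewrite /prefers_matching !(matched_partner _ sE) // negbK.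
have -> : [exists v, exists w, [&& [set u; v] \in M, [set u; w] \in N & pref u v w]] =
   [&& partner M u != u, partner N u != u & pref u (partner M u) (partner N u)].
  apply/existsP/idP => [[v /existsP [w]]|/and3P [mu nu p]].
    rewrite (mem_matching _ _ sE mM) (mem_matching _ _ sE mN).
    by case/and3P => /andP [/eqP -> uv] /andP [/eqP -> uw] ->; rewrite ![_ == u]eq_sym uv uw.
  exists (partner M u); apply/existsP; exists (partner N u).
  by rewrite (partner_edge sE mM) // (partner_edge sE mN).
by case: (partner M u != u) => //=; case: eqVneq.
Qed.

Lemma voteE (V : finType) (E M N : {set {set V}}) (pref : V -> rel V) (u : V) :
  simple_edges E -> matching E M -> matching E N ->
  vote pref M N u =
    ((partner N u != u) && ((partner M u == u) || pref u (partner N u) (partner M u)))%:Z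
    - ((partner M u != u) && ((partner N u == u) || pref u (partner M u) (partner N u)))%:Z.
Proof. by move=> sE mM mN; rewrite /vote !(prefers_matchingE _ _ sE). Qed.

Lemma wtE (V : finType) (E M : {set {set V}}) (pref : V -> rel V) (u v : V) :
  simple_edges E -> matching E M -> [set u; v] \in E ->
  let m := partner M in
  wt E pref M u v =
    if ((m u == u) || pref u v (m u)) && ((m v == v) || pref v u (m v)) then 2
    else if ((m u != u) && pref u (m u) v) && ((m v != v) && pref v (m v) u) then -2
    else 0.
Proof.
move=> sE mM uvE m; rewrite /wt /blocks uvE /= !(matched_partner _ sE mM) !negbK.
have h1 x y : prefers_to_partner pref M x y = (m x != x) && pref x y (m x).
  apply/existsP/idP => [[w]|/andP [mx p]].
    rewrite (mem_matching _ _ sE mM) => /andP [/andP [/eqP <- xw] ->].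
    by rewrite eq_sym xw.
  by exists (m x); rewrite (partner_edge sE mM).
have h2 x y : prefers_partner_to pref M x y = (m x != x) && pref x (m x) y.
  apply/existsP/idP => [[w]|/andP [mx p]].
    rewrite (mem_matching _ _ sE mM) => /andP [/andP [/eqP <- xw] ->].
    by rewrite eq_sym xw.
  by exists (m x); rewrite (partner_edge sE mM).
by rewrite !h1 !h2 -/m; case: (m u == u); case: (m v == v).
Qed.

Lemma wtC (V : finType) (E M : {set {set V}}) (pref : V -> rel V) (u v : V) :
  wt E pref M u v = wt E pref M v u.
Proof. by rewrite /wt /blocks setUC [X in _ && X]andbC [X in if X then -2 else _]andbC. Qed.

(** Parity is what later sharpens the bound 1 on the weight of a path to the bound 0. *)
Lemma wt_even (V : finType) (E M : {set {set V}}) (pref : V -> rel V) (u v : V) :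
  exists t : int, wt E pref M u v = t + t.
Proof. by rewrite /wt; case: ifP => _; [exists 1|case: ifP => _; [exists (-1)|exists 0]]. Qed.

Lemma pref_irr (V : finType) (E : {set {set V}}) (pref : V -> rel V) (u v : V) :
  strict_rankings E pref -> [set u; v] \in E -> pref u v v = false.
Proof. by move=> rE uvE; case: (rE u) => irr _ _; apply: irr; rewrite inE. Qed.

Lemma pref_asym (V : finType) (E : {set {set V}}) (pref : V -> rel V) (u v w : V) :
  strict_rankings E pref -> [set u; v] \in E -> [set u; w] \in E -> v != w ->
  pref u w v = ~~ pref u v w.
Proof.
move=> rE uvE uwE vw; case: (rE u) => irr tr tot.
have vn : v \in neighbors E u by rewrite inE.
have wn : w \in neighbors E u by rewrite inE.
have := tot _ _ vn wn vw; case p: (pref u v w) => //= _.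
by apply/negP => q; have := tr _ _ _ wn vn vn p q; rewrite irr.
Qed.

Lemma wt_matched (V : finType) (E M : {set {set V}}) (pref : V -> rel V) (u v : V) :
  simple_edges E -> strict_rankings E pref -> matching E M -> [set u; v] \in M ->
  wt E pref M u v = 0.
Proof.
move=> sE rE mM uvM; case/andP: (mM) => /subsetP sME _.
have vuM : [set v; u] \in M by rewrite setUC.
rewrite (wtE _ sE mM (sME _ uvM)).
move: (uvM) (vuM); rewrite !(mem_matching _ _ sE mM) => /andP [/eqP -> uv] /andP [/eqP -> vu].
by rewrite (negPf uv) (negPf vu) (pref_irr rE (sME _ uvM)) (pref_irr rE (sME _ vuM)).
Qed.

(** On an edge of [N] outside [M], an endpoint votes +1 if it is unmatched in [M] or prefers the
    edge, and -1 otherwise, since rankings are strict. The two votes add up to 2, -2 or 0 exactly as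
    in the definition of the weight. *)
Lemma vote_edge (V : finType) (E M N : {set {set V}}) (pref : V -> rel V) (u v : V) :
  simple_edges E -> strict_rankings E pref -> matching E M -> matching E N ->
  [set u; v] \in N -> wt E pref M u v = vote pref M N u + vote pref M N v.
Proof.
move=> sE rE mM mN uvN; case/andP: (mN) => /subsetP sNE _.
case/andP: (mM) => /subsetP sME _.
have vuN : [set v; u] \in N by rewrite setUC.
have uvE := sNE _ uvN; have vuE := sNE _ vuN.
rewrite !(voteE _ _ sE mM mN).
move: (uvN) (vuN); rewrite !(mem_matching _ _ sE mN) => /andP [/eqP -> uv] /andP [/eqP -> vu].
rewrite (negPf uv) (negPf vu) /=.
(* On an edge common to both matchings both sides vanish. *)
case: (boolP ([set u; v] \in M)) => [uvM|uvM].
  have vuM : [set v; u] \in M by rewrite setUC.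
  rewrite (wt_matched sE rE mM uvM).
  move: (uvM) (vuM); rewrite !(mem_matching _ _ sE mM) => /andP [/eqP -> _] /andP [/eqP -> _].
  by rewrite (negPf uv) (negPf vu) (pref_irr rE uvE) (pref_irr rE vuE).
have vuM : [set v; u] \notin M by rewrite setUC.
rewrite (wtE _ sE mM uvE).
have key x y : [set x; y] \in E -> [set x; y] \notin M -> partner M x != x ->
    pref x (partner M x) y = ~~ pref x y (partner M x).
  move=> xyE xyM mx; apply: pref_asym rE _ _ _ => //.
    exact/sME/(partner_edge sE mM).
  by apply: contraNneq xyM => ->; apply: (partner_edge sE mM).
case: (boolP (partner M u == u)) => mu; case: (boolP (partner M v == v)) => mv //=.
- by rewrite (key _ _ vuE vuM mv); case: (pref _ _ _).
- by rewrite (key _ _ uvE uvM mu); case: (pref _ _ _).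
- by rewrite (key _ _ vuE vuM mv) (key _ _ uvE uvM mu); do 2!case: (pref _ _ _).
Qed.

Lemma vote_same (V : finType) (E M N : {set {set V}}) (pref : V -> rel V) (u : V) :
  simple_edges E -> matching E M -> matching E N ->
  partner N u = partner M u -> vote pref M N u = 0.
Proof.
move=> sE mM mN e; rewrite (voteE _ _ sE mM mN) e.
by case: (partner M u == u); rewrite ?subrr.
Qed.

Lemma vote_fixed (V : finType) (E M N : {set {set V}}) (pref : V -> rel V) (u : V) :
  simple_edges E -> matching E M -> matching E N ->
  partner N u = u -> vote pref M N u = - (partner M u != u)%:Z.
Proof. by move=> sE mM mN e; rewrite (voteE _ _ sE mM mN) e eqxx /= sub0r andbT. Qed.

(** * Alternating paths and cycles as node sequences indexed by natural numbers *)

(** Nodes pair off as (0,1), (2,3), and so on along the even edges; for even [k] the last node is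
    left over. Here [w] stands for weights, zero on the odd edges, which lie in [M], and [v] for
    votes. *)
Lemma sum_pairs (v w : nat -> int) (k : nat) :
  (forall i, (i < k)%N -> w i = if odd i then 0 else v i + v i.+1) ->
  \sum_(i < k.+1) v i = \sum_(i < k) w i + (if odd k then 0 else v k).
Proof.
elim: k => [|k IH] H; first by rewrite big_ord_recr !big_ord0.
rewrite big_ord_recr IH => [|i lik]; last by apply: H; lia.
rewrite [in RHS]big_ord_recr /= H //; case: (odd k) => /=; by rewrite ?addr0 ?addrA.
Qed.

Lemma mkseq_cons (T : Type) (z : nat -> T) (k : nat) :
  z 0 :: mkseq (fun i => z i.+1) k = mkseq z k.+1.
Proof. by rewrite /mkseq /= (iotaDl 1 0) -map_comp. Qed.

Lemma pairmap_mkseq (T S : Type) (h : T -> T -> S) (z : nat -> T) (k : nat) :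
  pairmap h (z 0) (mkseq (fun i => z i.+1) k) = mkseq (fun i => h (z i) (z i.+1)) k.
Proof.
elim: k z => [|k IH] z //.
by rewrite -mkseq_cons /= (IH (fun i => z i.+1)) (mkseq_cons (fun i => h (z i) (z i.+1))).
Qed.

Lemma path_mkseqP (T : Type) (r : rel T) (z : nat -> T) (k : nat) :
  reflect (forall i, (i < k)%N -> r (z i) (z i.+1))
          (path r (z 0) (mkseq (fun i => z i.+1) k)).
Proof.
apply: (iffP (pathP (z 0) )) => H i; rewrite ?size_mkseq => lik.
  have := H i; rewrite size_mkseq mkseq_cons !nth_mkseq //; last by lia.
  exact.
by rewrite mkseq_cons !nth_mkseq ?H //; lia.
Qed.

Lemma sorted_alternate_mkseqP (V : finType) (M : {set {set V}}) (e : nat -> {set V}) (k : nat) :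
  reflect (forall i, (i < k)%N -> (e i \in M) = (e 0 \in M) (+) odd i)
          (sorted (alternate M) (mkseq e k)).
Proof.
apply: (iffP (sortedP (e 0))); rewrite size_mkseq => H i lik.
  elim: i lik => [|i IH] lik; first by rewrite addbF.
  have := H i lik; rewrite !nth_mkseq; [|lia|lia].
  by rewrite /alternate IH /=; [case: (e 0 \in M); case: (odd i); case: (_ \in M)|lia].
rewrite !nth_mkseq; [|lia|lia].
by rewrite /alternate (H i.+1) // (H i) /=; [case: (e 0 \in M); case: (odd i)|lia].
Qed.

(** The bound is inclusive: [k] counts the edges of a path, whose nodes are [z 0] to [z k]. *)
Definition injective_upto (V : Type) (z : nat -> V) (k : nat) : Prop :=
  forall i j, (i <= k)%N -> (j <= k)%N -> z i = z j -> i = j.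

Lemma uniq_mkseqP (V : eqType) (z : nat -> V) (k : nat) :
  reflect (injective_upto z k) (uniq (mkseq z k.+1)).
Proof.
apply: (iffP (mkseq_uniqP _ _)) => H i j; first by move=> li lj; apply: H.
by rewrite !inE => li lj; apply: H.
Qed.

Lemma alternating_pathP (V : finType) (E M : {set {set V}}) (z : nat -> V) (k : nat) :
  reflect [/\ forall i, (i < k)%N -> [set z i; z i.+1] \in E, injective_upto z k &
     forall i, (i < k)%N -> ([set z i; z i.+1] \in M) = ([set z 0; z 1] \in M) (+) odd i]
    (alternating_path E M (z 0) (mkseq (fun i => z i.+1) k)).
Proof.
rewrite /alternating_path /path_edges pairmap_mkseq mkseq_cons.
apply: (iffP and3P) => [] [H1 H2 H3]; split.
- exact/(path_mkseqP (adjacent E)).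
- exact/uniq_mkseqP.
- exact/(sorted_alternate_mkseqP _ (fun i => [set z i; z i.+1])).
- exact/path_mkseqP.
- exact/uniq_mkseqP.
- exact/sorted_alternate_mkseqP.
Qed.

Lemma rcons_mkseq (T : Type) (z : nat -> T) (k : nat) :
  z k.+1 = z 0 -> rcons (mkseq (fun i => z i.+1) k) (z 0) = mkseq (fun i => z i.+1) k.+1.
Proof. by move=> zk; rewrite mkseqS zk. Qed.

(** The closing edge has index [k] and must alternate with edge 0, which forces [k] to be odd. *)
Lemma alternating_cycleP (V : finType) (E M : {set {set V}}) (z : nat -> V) (k : nat) :
  z k.+1 = z 0 ->
  reflect [/\ forall i, (i <= k)%N -> [set z i; z i.+1] \in E, injective_upto z k,
     odd k && (1 < k)%N &
     forall i, (i <= k)%N -> ([set z i; z i.+1] \in M) = ([set z 0; z 1] \in M) (+) odd i]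
    (alternating_cycle E M (z 0) (mkseq (fun i => z i.+1) k)).
Proof.
move=> zk; rewrite /alternating_cycle /path_edges /= rcons_mkseq // pairmap_mkseq.
pose e i := [set z i; z i.+1]; rewrite -/e.
have -> : cycle (alternate M) (mkseq e k.+1) =
    sorted (alternate M) (mkseq e k.+1) && alternate M (e k) (e 0).
  rewrite -mkseq_cons /= rcons_path; congr (_ && alternate M _ _).
  by case: k {zk} => // k; rewrite mkseqS last_rcons.
have -> : (z 0 \notin mkseq (fun i => z i.+1) k) && uniq (mkseq (fun i => z i.+1) k) =
  uniq (mkseq z k.+1) by rewrite -mkseq_cons.
rewrite size_mkseq.
apply: (iffP and4P) => [[H1 H2 H3 /andP [H4 H5]]|[H1 H2 /andP [ok k1] H4]].
  have H := elimT (sorted_alternate_mkseqP _ e k.+1) H4.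
  split.
  - by move=> i lik; apply: (elimT (path_mkseqP (adjacent E) z k.+1) H1).
  - exact/uniq_mkseqP.
  - rewrite andbC (H3 : (1 < k)%N) /=; move: H5; rewrite /alternate H //.
    by case: (odd k) => //; rewrite addbF eqxx.
  - exact: H.
split=> //.
- by apply/path_mkseqP => i lik; apply: H1.
- exact/uniq_mkseqP.
apply/andP; split; first by apply/sorted_alternate_mkseqP.
by rewrite /alternate /e (H4 k) // ok; case: (_ \in M).
Qed.

Lemma wt_pathE (V : finType) (E M : {set {set V}}) (pref : V -> rel V) (z : nat -> V) (k : nat) :
  wt_path E pref M (z 0) (mkseq (fun i => z i.+1) k) =
  \sum_(i < k) wt E pref M (z i) (z i.+1).
Proof.
rewrite /wt_path pairmap_mkseq /mkseq big_map.
by rewrite -(big_mkord xpredT (fun i => wt E pref M (z i) (z i.+1))) /index_iota subn0.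
Qed.

Lemma nth_mkseq_cons (T : Type) (x : T) (p : seq T) :
  p = mkseq (fun i => nth x (x :: p) i.+1) (size p).
Proof. by rewrite mkseq_nth. Qed.

(** With the next lemma, this allows the unmatched endpoint of a path to be taken as its first
    node. *)
Lemma wt_path_rev (V : finType) (E M : {set {set V}}) (pref : V -> rel V) (x : V) (p : seq V) :
  wt_path E pref M (last x p) (rev (belast x p)) = wt_path E pref M x p.
Proof.
rewrite /wt_path; elim: p x => [|y p IH] x //=; rewrite big_cons -(IH y) rev_cons.
rewrite -cats1 pairmap_cat big_cat /= big_seq1 addrC; congr (_ + _).
rewrite wtC; congr wt; case: p {IH} => //= a p.
by rewrite rev_cons last_rcons.
Qed.

Lemma alternating_path_rev (V : finType) (E M : {set {set V}}) (x : V) (p : seq V) :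
  alternating_path E M x p -> alternating_path E M (last x p) (rev (belast x p)).
Proof.
case/and3P => H1 H2 H3; apply/and3P; split.
- rewrite rev_path; apply: sub_path H1 => u v; rewrite /adjacent /=.
  by rewrite setUC.
- by rewrite -rev_rcons -lastI rev_uniq.
have -> : path_edges (last x p) (rev (belast x p)) = rev (path_edges x p).
  rewrite /path_edges; elim: p x {H1 H2 H3} => [|y p IH] x //=.
  rewrite !rev_cons -cats1 pairmap_cat /= IH cats1; congr rcons.
  rewrite setUC; congr [set _; _]; case: p {IH} => //= a p.
  by rewrite rev_cons last_rcons.
rewrite rev_sorted; apply: sub_sorted H3 => e f.
by rewrite /alternate /= eq_sym.
Qed.

(** * Swapping a matching along a sequence of nodes *)

(** The sequence is closed under [partner M], so its nodes can be rematched along the even edges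
    without touching the rest of [M]. For even [k] the node [z k] ends up unmatched. One statement
    serves paths and cycles. *)
Lemma swap_along (V : finType) (E M : {set {set V}}) (z : nat -> V) (k : nat) :
  simple_edges E -> matching E M -> injective_upto z k ->
  (forall i, (i <= k)%N -> exists2 j, (j <= k)%N & partner M (z i) = z j) ->
  (forall i, (i < k)%N -> ~~ odd i -> [set z i; z i.+1] \in E) ->
  exists N, [/\ matching E N,
    forall u, (forall i, (i <= k)%N -> u <> z i) -> partner N u = partner M u,
    forall i, (i < k)%N -> ~~ odd i -> partner N (z i) = z i.+1,
    forall i, (i <= k)%N -> odd i -> partner N (z i) = z i.-1 &
    ~~ odd k -> partner N (z k) = z k].
Proof.
move=> sE mM zI zM zE; set s := mkseq z k.+1.
have us : uniq s by apply/uniq_mkseqP.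
have iz i : (i <= k)%N -> index (z i) s = i.
  move=> lik; rewrite -[z i](nth_mkseq (z 0) z (n := k.+1)) //.
  by rewrite index_uniq // size_mkseq.
(* The partner function of the new matching; an index beyond [k] means that [u] is off the
   sequence. *)
pose n u := let i := index u s in
  if (i <= k)%N then (if odd i then z i.-1 else if (i < k)%N then z i.+1 else u)
  else partner M u.
have n_out u : (forall i, (i <= k)%N -> u <> z i) -> n u = partner M u.
  move=> H; rewrite /n; case: (leqP (index u s) k) => // lik; case: (H _ lik).
  by rewrite -{1}[u](nth_index (z 0) (s := s)) ?nth_mkseq // -index_mem size_mkseq.
have n_ev i : (i < k)%N -> ~~ odd i -> n (z i) = z i.+1.
  by move=> lik oi; rewrite /n (iz _ (ltnW lik)) (ltnW lik) (negPf oi) lik.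
have n_odd i : (i <= k)%N -> odd i -> n (z i) = z i.-1.
  by move=> lik oi; rewrite /n iz // lik oi.
have n_last : ~~ odd k -> n (z k) = z k.
  by move=> ok; rewrite /n iz // leqnn (negPf ok) ltnn.
have inP u : (exists2 i, (i <= k)%N & u = z i) \/ (forall i, (i <= k)%N -> u <> z i).
  case: (boolP (u \in s)) => [/mapP [i]|us'].
    by rewrite mem_iota => /andP [_ lik] ->; left; exists i.
  right=> i lik e; case/negP: us'; rewrite e; apply: map_f.
  by rewrite mem_iota.
have nK : involutive n.
  move=> u; case: (inP u) => [[i lik ->]|H].
    case: (boolP (odd i)) => oi.
      rewrite n_odd // n_ev ?prednK //; [by case: i oi lik| |]; lia.
    case: (eqVneq i k) => [ek|nk]; first by rewrite ek !n_last // -ek.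
    by rewrite n_ev ?n_odd //=; lia.
  (* If the old partner of a node lay on the sequence, closure would put the node itself there. *)
  rewrite !n_out ?(partnerK sE mM) // => i lik e.
  case: (zM i lik) => j ljk ej; case: (H j ljk).
  by rewrite -ej -e (partnerK sE mM).
have nE u : n u != u -> [set u; n u] \in E.
  case: (inP u) => [[i lik ->]|H].
    case: (boolP (odd i)) => oi.
      rewrite n_odd // => _; rewrite setUC.
      by case: i oi lik => //= i oi lik; apply: zE.
    case: (eqVneq i k) => [ek|nk]; first by rewrite ek !n_last ?eqxx // -ek.
    by move=> _; rewrite n_ev // ?zE //; lia.
  rewrite n_out // => mu; case/andP: (mM) => /subsetP sME _.
  exact/sME/(partner_edge sE mM).
have [mN pN] := matching_ofP sE nK nE.
exists (matching_of n); split=> // *; rewrite pN; auto.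
Qed.

Lemma sum_image_upto (V : finType) (z : nat -> V) (k : nat) (F : V -> int) :
  injective_upto z k ->
  \sum_(u in [set z (val i) | i : 'I_k.+1]) F u = \sum_(i < k.+1) F (z i).
Proof.
move=> zI; rewrite big_imset //=.
move=> i j _ _ /= e; apply: val_inj; apply: zI e; rewrite -ltnS.
  exact: ltn_ord i.
exact: ltn_ord j.
Qed.

Lemma sum_supported_upto (V : finType) (F : V -> int) (z : nat -> V) (k : nat) :
  injective_upto z k -> (forall u, (forall i, (i <= k)%N -> u <> z i) -> F u = 0) ->
  \sum_u F u = \sum_(i < k.+1) F (z i).
Proof.
move=> zI F0; rewrite -(sum_image_upto F zI) [RHS]big_mkcond.
apply: eq_bigr => u _; case: ifPn => // H; apply: F0 => i lik e.
by case/imsetP: H; exists (Ordinal (lik : i < k.+1)%N).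
Qed.

(* Swapping along a sequence of even length covering an unmatched node would enlarge M. *)
Lemma no_augmenting (V : finType) (E M : {set {set V}}) (z : nat -> V) (k : nat) :
  simple_edges E -> maximum_matching E M -> injective_upto z k ->
  (forall i, (i <= k)%N -> exists2 j, (j <= k)%N & partner M (z i) = z j) ->
  (forall i, (i < k)%N -> ~~ odd i -> [set z i; z i.+1] \in E) ->
  odd k -> partner M (z 0) != z 0.
Proof.
move=> sE maxM zI zM zE ok; apply/eqP => m0; case: (maxM) => mM _.
have [N [mN nout nev nodd _]] := swap_along sE mM zI zM zE.
have := maximum_card_fixed sE maxM mN; rewrite leqNgt => /negP; apply.
(* As [k] is odd, the even edges cover the whole sequence. So [N] leaves unmatched only nodes that
   [M] does, and no longer [z 0]. *)
have nfix i : (i <= k)%N -> partner N (z i) != z i.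
  move=> lik; case: (boolP (odd i)) => oi.
    rewrite nodd //; apply/eqP => /zI; lia.
  rewrite nev //; last by move: ok oi; lia.
  apply/eqP => /zI; move: ok oi; lia.
apply/proper_card/properP; split; last first.
  by exists (z 0); rewrite inE ?m0 ?eqxx ?nfix.
apply/subsetP => u; rewrite !inE => /eqP nu.
rewrite -nout ?nu // => i lik e; have := nfix i lik.
by rewrite -e nu eqxx.
Qed.

(** * A popular max-matching admits no positive alternating path or cycle *)

(** After the swap [z k] is unmatched in place of [z 0], so the result is still maximum. Popularity
    bounds the weight plus the vote of [z k], which is at least -1, by 0; evenness of the weight
    does the rest. *)
Lemma popular_even_path (V : finType) (E M : {set {set V}}) (pref : V -> rel V)
    (z : nat -> V) (k : nat) :
  simple_edges E -> strict_rankings E pref -> popular_max_matching E pref M ->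
  injective_upto z k -> (forall i, (i < k)%N -> [set z i; z i.+1] \in E) ->
  (forall i, (i < k)%N -> ([set z i; z i.+1] \in M) = odd i) ->
  (forall i, (i <= k)%N -> exists2 j, (j <= k)%N & partner M (z i) = z j) ->
  partner M (z 0) = z 0 -> ~~ odd k ->
  \sum_(i < k) wt E pref M (z i) (z i.+1) <= 0.
Proof.
move=> sE rE [maxM popM] zI zE zA zM m0 ok; case: (maxM) => mM _.
have [|N [mN nout nev nodd nlast]] := swap_along sE mM zI zM; first by move=> i /zE.
have nfix i : (i < k)%N -> partner N (z i) != z i.
  move=> lik; case: (boolP (odd i)) => oi.
    rewrite nodd // 1?ltnW //; apply/eqP => /zI; lia.
  rewrite nev //; apply/eqP => /zI; lia.
have /popM : maximum_matching E N.
  apply: (maximum_of_card_fixed sE maxM mN).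
  (* Trading [z 0] for [z k] keeps the count: either [k] is 0 and the two coincide, or [z k] is
     matched by the last edge, which lies in [M]. *)
  have -> : #|[set u | partner M u == u]| =
      #|z k |: ([set u | partner M u == u] :\ z 0)|.
    rewrite cardsU1 (cardsD1 (z 0) [set u | _]) !inE m0 eqxx; congr addn.
    case: (posnP k) => [->|k0]; first by rewrite eqxx.
    have -> : (partner M (z k) == z k) = false; last by rewrite andbF.
    have := zA k.-1; rewrite prednK // => /(_ (leqnn _)).
    have -> : odd k.-1 by lia.
    by rewrite setUC (mem_matching _ _ sE mM) => /andP [/eqP -> ne]; apply/negbTE; rewrite eq_sym.
  apply/subset_leq_card/subsetP => u; rewrite !inE => nu.
  case: eqVneq => //= uk; apply/andP; split.
    apply: contraNneq uk => e; case: (posnP k) => [->|k0]; first by rewrite e.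
    by have := nfix 0 k0; rewrite -e nu.
  rewrite -nout // => i lik e; move: nu uk; rewrite e => nu uk.
  have : (i < k)%N by rewrite ltn_neqAle lik andbT; apply: contraNneq uk => ->.
  by move/nfix; rewrite nu.
rewrite -[Delta _ _ _]opprK -sum_vote oppr_ge0.
rewrite (sum_supported_upto zI); last by move=> u /nout; apply: vote_same sE _ _.
rewrite (sum_pairs (v := fun i => vote pref M N (z i))
  (w := fun i => wt E pref M (z i) (z i.+1))); last first.
  move=> i lik; case: (boolP (odd i)) => oi.
    by apply: wt_matched rE _ _ => //; rewrite zA.
  apply: (vote_edge sE rE) => //; rewrite (mem_matching _ _ sE mN) nev // eqxx /=.
  by apply/eqP => /zI; lia.
rewrite (negPf ok) (vote_fixed _ sE mM mN) ?nlast //.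
have [t ->] : exists t : int, \sum_(i < k) wt E pref M (z i) (z i.+1) = t + t.
  apply: (big_ind (fun x => exists t : int, x = t + t)).
  - by exists 0.
  - by move=> _ _ [s ->] [t ->]; exists (s + t); rewrite addrACA.
  - by move=> i _; apply: wt_even.
by case: (_ != _); lia.
Qed.

(** For odd [k] the path ends with an edge outside [M]. If [z k] is unmatched, the path is
    augmenting; otherwise appending its partner adds weight 0 and reduces to the even case. *)
Lemma popular_path (V : finType) (E M : {set {set V}}) (pref : V -> rel V)
    (z : nat -> V) (k : nat) :
  simple_edges E -> strict_rankings E pref -> popular_max_matching E pref M ->
  injective_upto z k -> (forall i, (i < k)%N -> [set z i; z i.+1] \in E) ->
  (forall i, (i < k)%N -> ([set z i; z i.+1] \in M) = odd i) ->
  partner M (z 0) = z 0 ->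
  \sum_(i < k) wt E pref M (z i) (z i.+1) <= 0.
Proof.
move=> sE rE popM zI zE zA m0; case: (popM) => [[mM _] _].
have modd i : (i < k)%N -> odd i -> partner M (z i) = z i.+1.
  move=> lik oi; have := zA i lik; rewrite oi (mem_matching _ _ sE mM).
  by case/andP => /eqP.
have mev i : (0 < i <= k)%N -> ~~ odd i -> partner M (z i) = z i.-1.
  case: i => //= i lik; rewrite negbK => /(modd i lik) <-.
  exact: (partnerK sE mM).
have mclosed i : (i <= k)%N -> (odd i -> (i < k)%N) ->
    exists2 j, (j <= k)%N & partner M (z i) = z j.
  move=> lik oik; case: (boolP (odd i)) => oi.
    by exists i.+1; [apply: oik|apply: modd => //; apply: oik].
  case: (posnP i) => [->|i0]; first by exists 0%N.
  by exists i.-1; [lia|apply: mev => //; rewrite i0].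
case: (boolP (odd k)) => ok; last first.
  apply: popular_even_path => // i lik; apply: mclosed => // oi.
  by rewrite ltn_neqAle lik andbT; apply: contraNneq ok => <-.
case: (eqVneq (partner M (z k)) (z k)) => mk.
  suff /eqP [] : partner M (z 0) != z 0 by [].
  apply: (no_augmenting sE popM.1 zI _ (fun i lik _ => zE i lik) ok) => i lik.
  case: (eqVneq i k) => [->|ne]; first by exists k.
  by apply: mclosed => // _; rewrite ltn_neqAle ne.
(* The appended node is new: every earlier node is unmatched or has its partner among the nodes
   before [z k]. *)
have mz i : (i <= k)%N -> partner M (z k) <> z i.
  move=> lik e; have := partnerK sE mM (z k); rewrite e => e'.
  have: exists2 j, (j < k)%N & partner M (z i) = z j \/ i = k.
    case: (eqVneq i k) => [->|ne]; first by exists 0%N; [lia|right].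
    case: (boolP (odd i)) => oi.
      exists i.+1; last by left; apply: modd => //; lia.
      by move: ok oi ne lik; lia.
    case: (posnP i) => [->|i0]; first by exists 0%N; [lia|left].
    by exists i.-1; [lia|left; apply: mev => //; rewrite i0].
  case=> j ljk []; last by move=> ik; rewrite e ik eqxx in mk.
  by rewrite e' => /zI; lia.
pose y i := if (i <= k)%N then z i else partner M (z k).
have yz i : (i <= k)%N -> y i = z i by rewrite /y => ->.
have yk : y k.+1 = partner M (z k) by rewrite /y ltnn.
have yI : injective_upto y k.+1.
  move=> i j; rewrite [(i <= _)%N]leq_eqVlt [(j <= _)%N]leq_eqVlt !ltnS.
  case/orP => [/eqP -> | li] /orP [/eqP -> | lj] //; rewrite ?yk ?yz //.
  - by move/mz => /(_ lj).
  - by move/esym/mz => /(_ li).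
  - exact: zI.
have : \sum_(i < k.+1) wt E pref M (y i) (y i.+1) <= 0.
  have ykM : [set y k; y k.+1] \in M by rewrite yk yz // (partner_edge sE mM).
  apply: popular_even_path => //.
  - move=> i; rewrite ltnS leq_eqVlt => /orP [/eqP ->|lik]; last by rewrite !yz ?zE // ltnW.
    by case/andP: mM => /subsetP sME _; apply: sME.
  - move=> i; rewrite ltnS leq_eqVlt => /orP [/eqP ->|lik]; last by rewrite !yz ?zA // ltnW.
    by rewrite ykM ok.
  - move=> i; rewrite leq_eqVlt => /orP [/eqP ->|lik].
      by exists k => //; rewrite yk yz // (partnerK sE mM).
    rewrite ltnS in lik; rewrite yz //.
    case: (eqVneq i k) => [->|ne]; first by exists k.+1.
    have [|j ljk ->] := mclosed i lik.
      by move=> _; rewrite ltn_neqAle ne.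
    by exists j; [apply: leqW|rewrite yz].
  - by rewrite /= negbK.
rewrite big_ord_recr /= yk yz // (wt_matched sE rE mM (partner_edge sE mM mk)) addr0.
rewrite (eq_bigr (fun i : 'I_k => wt E pref M (z i) (z i.+1))) // => i _.
by rewrite !yz // ltnW.
Qed.

(** The swap rematches every node of the cycle, so the result is again maximum. The closing edge has
    odd index [k], hence lies in [M] and has weight 0; the sum therefore stops before it. *)
Lemma popular_cycle (V : finType) (E M : {set {set V}}) (pref : V -> rel V)
    (z : nat -> V) (k : nat) :
  simple_edges E -> strict_rankings E pref -> popular_max_matching E pref M ->
  z k.+1 = z 0 -> injective_upto z k -> odd k ->
  (forall i, (i <= k)%N -> [set z i; z i.+1] \in E) ->
  (forall i, (i <= k)%N -> ([set z i; z i.+1] \in M) = odd i) ->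
  \sum_(i < k) wt E pref M (z i) (z i.+1) <= 0.
Proof.
move=> sE rE [maxM popM] zk zI ok zE zA; case: (maxM) => mM _.
have modd i : (i <= k)%N -> odd i -> partner M (z i) = z i.+1.
  move=> lik oi; have := zA i lik; rewrite oi (mem_matching _ _ sE mM).
  by case/andP => /eqP.
have zM i : (i <= k)%N -> exists2 j, (j <= k)%N & partner M (z i) = z j.
  move=> lik; case: (boolP (odd i)) => oi.
    rewrite modd //; case: (eqVneq i k) => [->|ne]; first by rewrite zk; exists 0%N.
    by exists i.+1; rewrite // ltn_neqAle ne.
  case: i lik oi => [_ _|i lik /=].
    by exists k; rewrite // -zk -modd // (partnerK sE mM).
  by rewrite negbK => oi; exists i; [lia|rewrite -modd ?(partnerK sE mM) //; lia].
have [|N [mN nout nev nodd _]] := swap_along sE mM zI zM; first by move=> i /ltnW/zE.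
have /popM : maximum_matching E N.
  apply: (maximum_of_card_fixed sE maxM mN).
  apply/subset_leq_card/subsetP => u; rewrite !inE => nu.
  rewrite -nout // => i lik e; move: nu; rewrite e; case: (boolP (odd i)) => oi.
    rewrite nodd // => /eqP /zI; lia.
  rewrite nev //; last by move: ok oi; lia.
  move=> /eqP /zI; move: ok oi; lia.
rewrite -[Delta _ _ _]opprK -sum_vote oppr_ge0.
rewrite (sum_supported_upto zI); last by move=> u /nout; apply: vote_same sE _ _.
rewrite (sum_pairs (v := fun i => vote pref M N (z i))
  (w := fun i => wt E pref M (z i) (z i.+1))) ?ok ?addr0 //.
move=> i lik; case: (boolP (odd i)) => oi.
  by apply: wt_matched rE _ _ => //; rewrite zA // ltnW.
apply: (vote_edge sE rE) => //; rewrite (mem_matching _ _ sE mN) nev // eqxx /=.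
by apply/eqP => /zI; lia.
Qed.

(** * Walks under two involutions, and the components of the symmetric difference *)

(** The first step applies [g], so even edges come from [g] and odd ones from [f]. *)
Fixpoint walk (V : Type) (f g : V -> V) (x : V) (k : nat) : V :=
  if k is j.+1 then (if odd j then f else g) (walk f g x j) else x.

Lemma walk_odd (V : Type) (f g : V -> V) (x : V) (k : nat) :
  odd k -> walk f g x k.+1 = f (walk f g x k).
Proof. by move=> /= ->. Qed.

Lemma walk_even (V : Type) (f g : V -> V) (x : V) (k : nat) :
  ~~ odd k -> walk f g x k.+1 = g (walk f g x k).
Proof. by move=> /= /negPf ->. Qed.

(** The walk is followed up to its first repetition. Each step can be undone by the same involution,
    so the walk can only stall at a fixed point or return to its start. *)
Lemma walk_end (V : finType) (f g : V -> V) (x : V) :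
  involutive f -> involutive g ->
  exists2 k, injective_upto (walk f g x) k &
    walk f g x k.+1 = walk f g x k \/ odd k /\ walk f g x k.+1 = x.
Proof.
move=> fK gK; set z := walk f g x; pose P k := z k.+1 \in mkseq z k.+1.
have uz k : (forall j, (j < k)%N -> ~~ P j) -> uniq (mkseq z k.+1).
  elim: k => [//|k IH] H; rewrite mkseqS rcons_uniq IH ?andbT; first exact: H.
  by move=> j ljk; apply: H; apply: ltnW.
have exP : exists k, P k.
  case: (boolP [exists k : 'I_#|V|, P k]) => [/existsP [k Pk]|]; first by exists k.
  rewrite negb_exists => /forallP H.
  have /card_uniqP : uniq (mkseq z #|V|.+1).
    by apply: uz => j ljk; apply: (H (Ordinal ljk)).
  by rewrite size_mkseq => e; have := max_card (mem (mkseq z #|V|.+1)); rewrite e ltnn.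
case: (ex_minnP exP) => k Pk mink.
have zI : injective_upto z k.
  apply/uniq_mkseqP/uz => j ljk; apply/negP => /mink; lia.
exists k => //; case/mapP: Pk => j; rewrite mem_iota /= => ljk.
rewrite -/(walk f g x k.+1) -/z => e; case: (eqVneq j k) => [jk|ne].
  by left; rewrite e jk.
have hK (b : bool) : involutive (if b then f else g) by case: b.
(* With equal parities the step out of [z j] leads back to [z k]; with different ones the step into
   [z j] shows that [z k] equals the predecessor of [z j], unless [j] is 0. *)
case: (eqVneq (odd j) (odd k)) => [pjk|pjk].
  have : z j.+1 = z k by rewrite -(hK (odd k) (z k)) -[X in _ = _ X]/(z k.+1) e -pjk.
  by move/zI; move: pjk; lia.
case: j => [|j] in e ljk ne pjk *; first by right; split=> //; case: (odd k) pjk.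
have pjk' : odd j = odd k by move: pjk; rewrite /=; do 2!case: odd.
have : z k = z j by apply: (inv_inj (hK (odd k))); rewrite -[LHS]/(z k.+1) e -pjk'.
by move/zI; lia.
Qed.

(** Each node is joined to its neighbours on the walk by the two involutions; only [f] at the start
    needs care, and there [x] is fixed or the walk closes up through [f]. *)
Lemma walk_closed (V : finType) (f g : V -> V) (x : V) (k i : nat) :
  involutive f -> involutive g ->
  (f x = x /\ walk f g x k.+1 = walk f g x k) \/ (odd k /\ walk f g x k.+1 = x) ->
  (i <= k)%N ->
  (exists2 j, (j <= k)%N & f (walk f g x i) = walk f g x j) /\
  (exists2 j, (j <= k)%N & g (walk f g x i) = walk f g x j).
Proof.
move=> fK gK; set z := walk f g x => zk lik.
have zS : exists2 j, (j <= k)%N & z i.+1 = z j.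
  case: (eqVneq i k) => [->|ne]; last by exists i.+1; rewrite // ltn_neqAle ne.
  by case: zk => [[_ ->]|[_ ->]]; [exists k|exists 0%N].
case: (boolP (odd i)) => oi.
  split; first by rewrite -walk_odd.
  case: i oi lik {zS} => // i oi lik; exists i; first exact: ltnW.
  by rewrite /z walk_even ?gK.
split; last by rewrite -walk_even.
case: i oi lik {zS} => [_ _|i oi lik].
  case: zk => [[fx _]|[ok zk]]; first by exists 0%N.
  by exists k => //; apply: (inv_inj fK); rewrite fK /z -walk_odd.
by exists i; [exact: ltnW|rewrite /z walk_odd ?fK //; move: oi; rewrite /= negbK].
Qed.

Lemma mem_walk (V : finType) (f g : V -> V) (S : {set V}) (x : V) (k : nat) :
  {in S, forall u, f u \in S /\ g u \in S} -> x \in S -> walk f g x k \in S.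
Proof.
move=> Sfg xS; elim: k => //= k /Sfg [fS gS].
by case: (odd k).
Qed.

(* The walk alternating between partners in N and in M traces a component of
   the symmetric difference of M and N. *)
Lemma component_vote_le0 (V : finType) (E M N : {set {set V}}) (pref : V -> rel V)
    (S : {set V}) :
  simple_edges E -> strict_rankings E pref ->
  maximum_matching E M -> maximum_matching E N ->
  (~ exists x p, alternating_cycle E M x p /\ 0 < wt_cycle E pref M x p) ->
  (~ exists x p, [/\ alternating_path E M x p,
           ~~ matched M x || ~~ matched M (last x p) & 0 < wt_path E pref M x p]) ->
  {in S, forall u, partner M u \in S /\ partner N u \in S} -> S != set0 ->
  exists z k, [/\ injective_upto z k, forall i, z i \in S,
    forall i, (i <= k)%N ->
      (exists2 j, (j <= k)%N & partner M (z i) = z j) /\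
      (exists2 j, (j <= k)%N & partner N (z i) = z j) &
    \sum_(i < k.+1) vote pref M N (z i) <= 0].
Proof.
move=> sE rE maxM maxN noC noP clS neS.
case: (maxM) => mM _; case: (maxN) => mN _.
have mK := partnerK sE mM; have nK := partnerK sE mN.
case/andP: (mM) => /subsetP sME _; case/andP: (mN) => /subsetP sNE _.
set m := partner M; set n := partner N.
have edges x k : let z := walk m n x in injective_upto z k -> forall i, (i < k)%N ->
    if odd i then [set z i; z i.+1] \in M else [set z i; z i.+1] \in N.
  move=> z zI i lik; have zi : z i != z i.+1 by apply/eqP => /zI; lia.
  case: ifPn => oi; rewrite (mem_matching _ _ sE) // zi andbT.
    by rewrite /z walk_odd.
  by rewrite /z walk_even.
have sums x k : let z := walk m n x in injective_upto z k ->
    \sum_(i < k.+1) vote pref M N (z i) =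
    \sum_(i < k) wt E pref M (z i) (z i.+1) + (if odd k then 0 else vote pref M N (z k)).
  move=> z zI; apply: (sum_pairs (v := fun i => vote pref M N (z i))
                     (w := fun i => wt E pref M (z i) (z i.+1))) => i lik.
  have := edges x k zI i lik; case: ifP => _ H; first exact: wt_matched H.
  exact: vote_edge H.
have edgeE x k : let z := walk m n x in injective_upto z k -> forall i, (i < k)%N ->
    [set z i; z i.+1] \in E.
  by move=> z zI i lik; have := edges x k zI i lik; case: ifP => _; [apply: sME|apply: sNE].
(* [m x != z 1] keeps the first edge out of [M]; for later even edges, the partner in [M] is the
   preceding node, and injectivity separates it from the next one. *)
have alt x k : let z := walk m n x in injective_upto z k -> m x != z 1 ->
    forall i, (i < k)%N -> ([set z i; z i.+1] \in M) = odd i.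
  move=> z zI mx i lik; have := edges x k zI i lik; case: ifPn => oi H //.
  apply/negbTE; rewrite (mem_matching _ _ sE mM) negb_and; apply/orP; left.
  case: i oi lik {H} => [_ _|i oi lik] //.
  rewrite [z i.+1]walk_odd; last by move: oi; rewrite /= negbK.
  by rewrite mK -/(z i); apply/eqP => /zI; lia.
(* A node unmatched in [M] starts a path component: if the walk returned to [x] through [m], then
   [z k] would already equal [x]. *)
case: (pickP [pred x in S | m x == x]) => [x /andP [xS /eqP mx]|noM].
  have [k zI zk] := walk_end x mK nK.
  have {}zk : walk m n x k.+1 = walk m n x k.
    case: zk => // [[ok zk]]; have : walk m n x k = x.
      by rewrite -[LHS]mK -/m -walk_odd // zk.
    by move/(zI k 0%N (leqnn _) (leq0n _)) => k0; rewrite k0 in ok.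
  exists (walk m n x), k; split=> //.
  - by move=> i; apply: mem_walk.
  - by move=> i lik; apply: walk_closed => //; left.
  rewrite sums //; set W := \sum_(i < k) _.
  have W0 : W <= 0.
    rewrite leNgt; apply/negP => Wpos; apply: noP.
    exists (walk m n x 0), (mkseq (fun i => walk m n x i.+1) k).
    rewrite wt_pathE (matched_partner _ sE mM) negbK -/m mx eqxx; split=> //.
    apply/alternating_pathP; split=> //; first exact: edgeE.
    case: k => [|k] // in zI {zk W Wpos} *.
    have x1 : m x != walk m n x 1 by rewrite mx; apply/eqP => /(zI 0%N 1%N); lia.
    by move=> i lik; rewrite (alt x k.+1) // (alt x k.+1 zI x1 0%N).
  case: (boolP (odd k)) => ok; first by rewrite addr0.
  rewrite (vote_fixed _ sE mM mN); last by rewrite -/n -walk_even.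
  by case: (_ != _); lia.
(* Now [M] matches all of [S]. A node unmatched in [N] would start a path with both ends unmatched
   in [N], augmenting [N]; the walk has the roles of [m] and [n] exchanged. *)
case: (pickP [pred x in S | n x == x]) => [x /andP [xS /eqP nx]|noN].
  have [k zI zk] := walk_end x nK mK.
  have clS' : {in S, forall u, n u \in S /\ m u \in S} by move=> u /clS [].
  have zS i : walk n m x i \in S by apply: mem_walk.
  have {}zk : walk n m x k.+1 = walk n m x k.
    case: zk => // [[ok zk]]; have : walk n m x k = x.
      by rewrite -[LHS]nK -/n -walk_odd // zk.
    by move/(zI k 0%N (leqnn _) (leq0n _)) => k0; rewrite k0 in ok.
  have ok : odd k.
    apply: contraFT (noM (walk n m x k)) => ok.
    by rewrite inE /= zS -walk_even // zk eqxx.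
  suff /eqP [] : partner N (walk n m x 0) != walk n m x 0 by [].
  apply: (no_augmenting sE maxN zI) ok => i lik.
    by have [] : _ /\ _ := walk_closed nK mK (or_introl (conj nx zk)) lik.
  move=> oi; rewrite walk_even //; apply: sME; apply: (partner_edge sE mM).
  by apply/negP => mz; have := noM (walk n m x i); rewrite /= zS mz.
(* Both matchings now cover [S], so any node lies on a closed walk. *)
have /set0Pn [x xS] := neS.
have [k zI zk] := walk_end x mK nK; have zS i : walk m n x i \in S by apply: mem_walk.
have {zk} [ok zk] : odd k /\ walk m n x k.+1 = x.
  case: zk => // zk; case: (boolP (odd k)) => ok.
    by have := noM (walk m n x k); rewrite /= zS -walk_odd // zk eqxx.
  by have := noN (walk m n x k); rewrite /= zS -walk_even // zk eqxx.
exists (walk m n x), k; split=> //.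
  by move=> i lik; apply: walk_closed => //; right.
rewrite sums // ok addr0.
have mx : m x = walk m n x k by rewrite -[x in m x]zk walk_odd // mK.
have ekM : [set walk m n x k; walk m n x k.+1] \in M.
  rewrite (mem_matching _ _ sE mM) -/m walk_odd // eqxx /=.
  by have := noM (walk m n x k); rewrite /= zS eq_sym /= => ->.
(* A closed walk on two nodes is an edge common to [M] and [N], not a cycle. *)
have [k1|k1] := leqP k 1.
  have {}k1 : k = 1%N by case: k ok k1 {zI zk mx ekM} => [|[]].
  rewrite k1 in ekM zk *; rewrite big_ord1 /=.
  by rewrite wtC (wt_matched sE rE mM) //; move: ekM; rewrite zk.
rewrite leNgt; apply/negP => Wpos; apply: noC.
exists (walk m n x 0), (mkseq (fun i => walk m n x i.+1) k); split; last first.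
  rewrite /wt_cycle (rcons_mkseq zk) wt_pathE big_ord_recr /=.
  by rewrite [X in _ + X](wt_matched sE rE mM ekM) addr0.
have x1 : m x != walk m n x 1 by rewrite mx; apply/eqP => /zI; lia.
have altk i : (i <= k)%N -> ([set walk m n x i; walk m n x i.+1] \in M) = odd i.
  rewrite leq_eqVlt => /orP [/eqP ->|lik]; first by rewrite ekM ok.
  exact: (alt x k zI x1).
apply/alternating_cycleP => //; split=> //; last 2 first.
- by rewrite ok.
- by move=> i lik; rewrite altk // altk.
move=> i; rewrite leq_eqVlt => /orP [/eqP ->|lik]; first exact: sME.
exact: (edgeE x k zI).
Qed.

(** Components are split off one at a time, by induction on the size of [S]; what remains is closed
    under both partner maps because they are involutions. *)
Lemma sum_vote_le0 (V : finType) (E M N : {set {set V}}) (pref : V -> rel V) (S : {set V}) :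
  simple_edges E -> strict_rankings E pref ->
  maximum_matching E M -> maximum_matching E N ->
  (~ exists x p, alternating_cycle E M x p /\ 0 < wt_cycle E pref M x p) ->
  (~ exists x p, [/\ alternating_path E M x p,
           ~~ matched M x || ~~ matched M (last x p) & 0 < wt_path E pref M x p]) ->
  {in S, forall u, partner M u \in S /\ partner N u \in S} ->
  \sum_(u in S) vote pref M N u <= 0.
Proof.
move=> sE rE maxM maxN noC noP; case: (maxM) => mM _; case: (maxN) => mN _.
have [c] := ubnP #|S|; elim: c S => // c IH S leS clS.
have [->|neS] := eqVneq S set0; first by rewrite big_set0.
have [z [k [zI zS zcl le0]]] := component_vote_le0 sE rE maxM maxN noC noP clS neS.
set Z := [set z (val i) | i : 'I_k.+1].
have memZ i : (i <= k)%N -> z i \in Z.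
  by move=> lik; apply/imsetP; exists (Ordinal (lik : i < k.+1)%N).
have ZS : Z \subset S by apply/subsetP => u /imsetP [i _ ->].
have clZ u : u \in Z -> partner M u \in Z /\ partner N u \in Z.
  case/imsetP => i _ ->; have [[j lj ->] [l ll ->]] := zcl i (ltn_ord i).
  by split; apply: memZ.
rewrite (big_setID Z) /= (setIidPr ZS) (sum_image_upto _ zI).
rewrite -[0]addr0; apply: lerD => //; apply: IH.
  have : (0 < #|Z|)%N by apply/card_gt0P; exists (z 0); apply: memZ.
  move=> Z0; rewrite -ltnS; apply: leq_trans leS.
  by rewrite ltnS -(cardsID Z S) (setIidPr ZS) -[X in (X < _)%N]add0n ltn_add2r.
move=> u; rewrite !inE => /andP [uZ /clS [-> ->]]; rewrite !andbT.
split; apply: contra uZ => /clZ []; first by rewrite (partnerK sE mM).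
by rewrite (partnerK sE mN).
Qed.

(** * The equivalence, after normalizing where cycles and paths start *)

Theorem theorem2 (V : finType) (A B : {set V}) (E : {set {set V}})
    (pref : V -> rel V) (M : {set {set V}})
    (bipE : bipartite A B E) (rankE : strict_rankings E pref)
    (maxM : maximum_matching E M) :
  popular_max_matching E pref M <->
  (~ exists (x : V) (p : seq V),
       alternating_cycle E M x p /\ 0 < wt_cycle E pref M x p) /\
  (~ exists (x : V) (p : seq V),
       [/\ alternating_path E M x p,
           ~~ matched M x || ~~ matched M (last x p) &
           0 < wt_path E pref M x p]).
Proof.
have sE := bipartite_simple bipE; case: (maxM) => mM _.
split=> [popM|[noC noP]]; last first.
  split=> // N maxN; rewrite -oppr_le0 -sum_vote.
  have := sum_vote_le0 (S := [set: V]) sE rankE maxM maxN noC noP.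
  by rewrite (eq_bigl xpredT) => [|u]; rewrite ?inE //; apply=> u _; rewrite !inE.
split.
  case=> x [p []]; rewrite /wt_cycle; set z := nth x (x :: p); set k := size p.
  have -> : p = mkseq (fun i => z i.+1) k := nth_mkseq_cons x p.
  have zk : z k.+1 = z 0 by rewrite /z nth_default.
  rewrite -[x]/(z 0) (rcons_mkseq zk) wt_pathE => /(alternating_cycleP _ _ zk).
  case=> zE zI /andP [ok k1] zA; rewrite ltNge => /negP; apply.
  (* [popular_cycle] wants the edges of [M] at odd indices; if the first edge lies in [M], the cycle
     is rotated by one node into [y]. *)
  case: (boolP ([set z 0; z 1] \in M)) => b0; last first.
    rewrite big_ord_recr /= (wt_matched sE rankE mM); last by rewrite zA // (negPf b0) ok.
    rewrite addr0; apply: popular_cycle => // i lik.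
    by rewrite zA // (negPf b0).
  pose y i := if (i <= k)%N then z i.+1 else z 1.
  have yz i : (i <= k)%N -> y i = z i.+1 by rewrite /y => ->.
  have yk : y k.+1 = y 0 by rewrite /y ltnn.
  rewrite big_ord_recl (wt_matched sE rankE mM b0) add0r.
  rewrite (eq_bigr (fun i : 'I_k => wt E pref M (y i) (y i.+1))); last first.
    by move=> i _; rewrite !yz //; apply: ltnW (ltn_ord i).
  have yE i : (i <= k)%N ->
      [set y i; y i.+1] = if (i < k)%N then [set z i.+1; z i.+2] else [set z 0; z 1].
    move=> lik; rewrite yz //; case: ltnP => [lk|lk]; first by rewrite yz.
    have -> : i = k by apply/eqP; rewrite eqn_leq lik.
    by rewrite zk yk yz.
  apply: popular_cycle => //.
  - move=> i j li lj; rewrite !yz //; case: (eqVneq i k) (eqVneq j k) => [->|ik] [->|jk] //.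
    + by rewrite zk => /zI; lia.
    + by rewrite zk => /zI; lia.
    + by move=> /zI; lia.
  - by move=> i lik; rewrite yE //; case: ifP => lk; [apply: (zE i.+1)|apply: (zE 0%N)].
  - move=> i lik; rewrite yE //; case: ltnP => [lk|lk]; first by rewrite zA // b0 /= negbK.
    have -> : i = k by apply/eqP; rewrite eqn_leq lik.
    by rewrite b0 ok.
have noP x p : alternating_path E M x p -> ~~ matched M x -> wt_path E pref M x p <= 0.
  set z := nth x (x :: p); set k := size p.
  have -> : p = mkseq (fun i => z i.+1) k := nth_mkseq_cons x p.
  rewrite -[x]/(z 0) wt_pathE => /alternating_pathP [zE zI zA].
  rewrite (matched_partner _ sE mM) negbK => /eqP m0.
  apply: popular_path => // i lik; rewrite zA //.
  (* An unmatched start keeps the first edge out of [M], which fixes the parity of the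
     alternation. *)
  case: (boolP (_ \in M)) => // b0; have k0 : (0 < k)%N by lia.
  move: b0; rewrite (mem_matching _ _ sE mM) m0 => /andP [/eqP /zI].
  by lia.
case=> x [p [aP /orP [] um]]; rewrite ltNge => /negP; apply; first exact: noP.
rewrite -wt_path_rev; apply: noP => //.
exact: alternating_path_rev.
Qed.
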